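(* Consider the power network with noisy measurements described in the context, with homogeneous parameters, i.e. for all buses $i$: $M_i=m$, $M_i^v=m^v$, $D_i=d$, $R_i^g=r^g$, $R_i^r=r^r$, $k_i^1=k_1$, $k_i^2=k_2$, $k_i^3=k_3$. Let $H_{DC}$ denote the input-output system when all inverters implement droop control ($m^v=0$, $k_3=0$), and let $H_{VI}$ denote the input-output system when all inverters implement virtual inertia ($m^v>0$, $k_3\neq0$). Then $$\|H_{DC}\|_{\mathcal H_2}^2=\frac{n\left(k_1^2+(k_2/r^r)^2\right)}{2m\left(d+\frac1{r^g}+\frac1{r^r}\right)}\qquad\text{and}\qquad \|H_{VI}\|_{\mathcal H_2}^2=+\infty .$$
   Context: The network is a connected graph with buses $N=\{1,\dots,n\}$ and symmetric line susceptances $b_{ij}>0$; $L_B$ is the $b_{ij}$-weighted graph Laplacian ($(L_B)_{ij}=-b_{ij}$ for lines $ij$, $i\ne j$; $(L_B)_{ii}=\sum_{k}b_{ik}$ over neighbors $k$; $0$ otherwise). The inertia $M_i$, damping $D_i$, generator droop coefficient $R_i^g$ and inverter droop coefficient $R_i^r$ are positive; $M_i^v\ge0$ is the virtual inertia; $k_i^1,k_i^2,k_i^3\in\mathbb R$ are noise gains (for demand fluctuation, frequency measurement noise, and frequency-derivative measurement noise). Put $M=\mathrm{diag}(M_i)$, $M^v=\mathrm{diag}(M_i^v)$, $\hat M=M+M^v$, $D=\mathrm{diag}(D_i)$, $R^g=\mathrm{diag}(R^g_i)$, $R^r=\mathrm{diag}(R^r_i)$, $\hat D=D+(R^g)^{-1}+(R^r)^{-1}$,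 $K_x=\mathrm{diag}(k_i^x)$ for $x=1,2,3$. The system, in deviations $(\delta\theta,\delta\omega)\in\mathbb R^{2n}$ from steady state, is $$\dot{\delta\theta}=\delta\omega,\qquad \hat M\,\dot{\delta\omega}=-L_B\,\delta\theta-\hat D\,\delta\omega+K_1w_1-(R^r)^{-1}K_2w_2-M^vK_3w_3,\qquad y=\delta\omega,$$ where $w_1,w_2$ are uncorrelated $\mathbb R^n$-valued white noise processes with unit covariance, $E[w_k(\tau)w_k(t)^T]=\delta(t-\tau)I_n$, and $w_3=\frac{d}{dt}w_2$, i.e. in the Laplace domain $\hat w_3(s)=s\,\hat w_2(s)$. The squared norm is $\|H\|_{\mathcal H_2}^2=\lim_{t\to\infty}E[y(t)^Ty(t)]$. Because $w_3$ is the derivative of $w_2$, this is understood as the (frequency-weighted) $\mathcal H_2$ norm of the transfer function $H(s)$ from $(w_1,w_2)$ to $y$ obtained by substituting $\hat w_3(s)=s\hat w_2(s)$, i.e. $\|H\|_{\mathcal H_2}^2=\frac1{2\pi}\int_{-\infty}^{\infty}\mathrm{tr}\big(H(\mathbf i\xi)^*H(\mathbf i\xi)\big)\,d\xi\in[0,+\infty]$. *)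

(* Defs.v *)
From HB Require Import structures.
From mathcomp Require Import all_boot all_order all_algebra.
From mathcomp Require Import all_classical all_reals all_analysis.
From mathcomp Require Import complex.

Set Implicit Arguments.
Unset Strict Implicit.
Unset Printing Implicit Defensive.

Import Order.TTheory GRing.Theory Num.Theory.
Import numFieldNormedType.Exports.

Local Open Scope ring_scope.
Local Open Scope complex_scope.

(** Power networks *)

Record network (R : realType) (n : nat) := Network {
  line : rel 'I_n;
  suscept : 'I_n -> 'I_n -> R;
  inertia : 'I_n -> R;
  vinertia : 'I_n -> R;
  damping : 'I_n -> R;
  gen_droop : 'I_n -> R;
  inv_droop : 'I_n -> R;
  gain1 : 'I_n -> R;  (* demand fluctuation *)
  gain2 : 'I_n -> R;  (* frequency measurement noise *)
  gain3 : 'I_n -> R;  (* frequency-derivative measurement noise *)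
  bus_nonempty : (0 < n)%N;
  line_sym : symmetric line;
  line_irr : irreflexive line;
  line_connected : forall i j, connect line i j;
  suscept_sym : forall i j, suscept i j = suscept j i;
  suscept_gt0 : forall i j, line i j -> 0 < suscept i j;
  inertia_gt0 : forall i, 0 < inertia i;
  vinertia_ge0 : forall i, 0 <= vinertia i;
  damping_gt0 : forall i, 0 < damping i;
  gen_droop_gt0 : forall i, 0 < gen_droop i;
  inv_droop_gt0 : forall i, 0 < inv_droop i
}.

Section Matrices.
Context (R : realType) (n : nat) (P : network R n).

Definition laplacian : 'M[R]_n :=
  \matrix_(i, j)
    (if i == j then \sum_(k | line P i k) suscept P i k
     else if line P i j then - suscept P i j else 0).

Definition diag_of (f : 'I_n -> R) : 'M[R]_n := diag_mx (\row_i f i).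

Definition Mv : 'M[R]_n := diag_of (vinertia P).
Definition Mhat : 'M[R]_n := diag_of (inertia P) + Mv.
Definition Rg : 'M[R]_n := diag_of (gen_droop P).
Definition Rr : 'M[R]_n := diag_of (inv_droop P).
Definition Dhat : 'M[R]_n := diag_of (damping P) + invmx Rg + invmx Rr.
Definition K1 : 'M[R]_n := diag_of (gain1 P).
Definition K2 : 'M[R]_n := diag_of (gain2 P).
Definition K3 : 'M[R]_n := diag_of (gain3 P).

(* State (dtheta, domega), input (w1, w2, w3), output domega; the swing
   equation is solved for the derivative of domega by multiplying with
   [invmx Mhat]. *)
Definition sysA : 'M[R]_(n + n) :=
  block_mx 0 1%:M
           (- (invmx Mhat *m laplacian)) (- (invmx Mhat *m Dhat)).

Definition sysB : 'M[R]_(n + n, n + (n + n)) :=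
  col_mx 0
    (invmx Mhat *m row_mx K1 (row_mx (- (invmx Rr *m K2)) (- (Mv *m K3)))).

Definition sysC : 'M[R]_(n, n + n) := row_mx 0 1%:M.

End Matrices.

(** Transfer functions and the H2 norm *)

Definition complexify (R : realType) (p q : nat) (A : 'M[R]_(p, q)) :
    'M[R[i]]_(p, q) := map_mx (real_complex R) A.

(* C (s I - A)^-1 B.  Where s I - A is singular, [invmx] returns its argument;
   for [sysA] this happens on the imaginary axis only at s = 0 (kernel of the
   Laplacian), a null set for the integral in [H2norm_sq]. *)
Definition transfer (R : realType) (N p q : nat) (A : 'M[R]_N)
    (B : 'M[R]_(N, q)) (C : 'M[R]_(p, N)) (s : R[i]) : 'M[R[i]]_(p, q) :=
  complexify C *m invmx (s%:M - complexify A) *m complexify B.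

(* (w1, w2) |-> (w1, w2, s w2): in the Laplace domain w3 = s w2. *)
Definition noise_input (R : realType) (n : nat) (s : R[i]) :
    'M[R[i]]_(n + (n + n), n + n) :=
  col_mx (row_mx 1%:M 0) (col_mx (row_mx 0 1%:M) (row_mx 0 s%:M)).

Definition network_transfer (R : realType) (n : nat) (P : network R n)
    (s : R[i]) : 'M[R[i]]_(n, n + n) :=
  transfer (sysA P) (sysB P) (sysC R n) s *m noise_input n s.

Definition adjoint_mx (R : realType) (p q : nat) (A : 'M[R[i]]_(p, q)) :
    'M[R[i]]_(q, p) := map_mx conjc A^T.

(* The trace of H^* H is a nonnegative real, so taking [complex.Re] only
   changes its type. *)
Definition H2norm_sq (R : realType) (p q : nat)
    (H : R[i] -> 'M[R[i]]_(p, q)) : \bar R :=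
  (((2 * pi)^-1)%:E *
   \int[@lebesgue_measure R]_(xi in setT)
     (complex.Re (\tr (adjoint_mx (H (0 +i* xi)) *m H (0 +i* xi))))%:E)%E.

(** Homogeneous parameters *)

Definition homogeneous (R : realType) (n : nat) (P : network R n)
    (m mv d rg rr k1 k2 k3 : R) : Prop :=
  forall i : 'I_n,
    (inertia P i = m /\ vinertia P i = mv /\ damping P i = d) /\
    (gen_droop P i = rg /\ inv_droop P i = rr) /\
    (gain1 P i = k1 /\ gain2 P i = k2 /\ gain3 P i = k3).

(* Main.v *)
Require Import Defs.
From HB Require Import structures.
From mathcomp Require Import all_boot all_order all_algebra.
From mathcomp Require Import all_classical all_reals all_analysis.
From mathcomp Require Import measurable_realfun complex spectral sesquilinear.
From mathcomp Require Import ring lra.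

(** With homogeneous parameters the Laplacian L is diagonalised by a unitary
    matrix, with eigenvalues l_i >= 0, and the transfer function is
      H(s) = s (a s^2 + c s + L)^-1 [k1 I, - (k2 / rr + s mv k3) I]
    with a = m + mv and c = d + 1/rg + 1/rr.  Hence tr(H^* H) at s = i xi is
    k1^2 + (k2/rr)^2 + (xi mv k3)^2 times the sum over i of
      xi^2 / ((l_i - a xi^2)^2 + (c xi)^2),
    whose integral pi / (a c) does not depend on l_i: for l > 0, splitting it at
    sqrt (l / a) and reflecting one part by x |-> l / (a x) leaves the derivative
    of an arctangent.  When mv k3 <> 0 the trace is bounded below by a positive
    constant for xi >= 1. *)

Import Order.TTheory GRing.Theory Num.Theory.
Import numFieldNormedType.Exports.
Local Open Scope ring_scope.

(** * Integral of the modal gain *)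

Section Integrals.
Local Open Scope classical_set_scope.

(** * Integration over the real line *)

(** Evenness doubles the integral over the half-line. The primitive is differentiated on [0 < x] and
    enters at 0 through a right limit, which suits an integral with base point 0. *)
Lemma even_ge0_FTC (R : realType) (f F : R -> R) (l : R) :
  (forall x, 0 <= f x) -> continuous f -> (forall x, f (- x) = f x) ->
  (forall x : R, 0 < x -> is_derive x 1 F (f x)) ->
  F x @[x --> 0^'+] --> F 0 -> F x @[x --> +oo] --> l ->
  (\int[@lebesgue_measure R]_x (f x)%:E = (2 * (l - F 0))%:E)%E.
Proof.
move=> f0 cf ef dF F0 Fl.
rewrite ge0_symfun_integralT//; last by move=> x /=; rewrite ef.
rewrite -set_itvcy (@ge0_continuous_FTC2y _ f F 0 l)//.
- exact: continuous_subspaceT.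
- by move=> x x0; have [] := dF _ x0.
- move=> x; rewrite in_itv/= andbT => x0.
  by rewrite derive1E; have [_] := dF _ x0.
Qed.

(** Singletons are Lebesgue null. This discards zero frequency, where the closed forms used below
    can fail. *)
Lemma eq_integral_off_point {R : realType} (r : R) (f g : R -> R) :
  measurable_fun [set: R] g -> (forall x, x != r -> f x = g x) ->
  (\int[@lebesgue_measure R]_x (f x)%:E = \int[@lebesgue_measure R]_x (g x)%:E)%E.
Proof.
move=> mg fg.
have mD : measurable ([set: R] `\ r) by apply: measurableD.
have mgD : measurable_fun ([set: R] `\ r) g by exact: measurable_funS mg.
rewrite -[LHS](@integral_setD1 _ _ r)//; last first.
  apply/measurable_EFinP; apply: eq_measurable_fun mgD => x.
  by rewrite inE => -[_ /eqP xr]; rewrite fg.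
rewrite -[RHS](@integral_setD1 _ _ r)//; last exact/measurable_EFinP.
by apply: eq_integral => x; rewrite inE => -[_ /eqP xr]; rewrite fg.
Qed.

Lemma measurable_fun_off_point {R : realType} (r : R) (f g : R -> R) :
  measurable_fun [set: R] g -> (forall x, x != r -> f x = g x) ->
  measurable_fun [set: R] f.
Proof.
move=> mg fg; rewrite -(@setD1K _ r [set: R])//.
apply/measurable_funU => //; first exact: measurableD.
split; first exact: measurable_fun_set1.
have : measurable_fun ([set: R] `\ r) g by exact: measurable_funS mg.
by apply: eq_measurable_fun => x; rewrite inE => -[_ /eqP xr]; rewrite fg.
Qed.

(** Comparison with the constant [e] on a half-line of infinite measure. *)
Lemma integral_ge1_pinfty {R : realType} (f : R -> R) (e : R) :
  measurable_fun [set: R] f -> (forall x, 0 <= f x) -> 0 < e ->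
  (forall x, 1 <= x -> e <= f x) ->
  (\int[@lebesgue_measure R]_x (f x)%:E = +oo)%E.
Proof.
move=> mf f0 e0 ef; apply/eqP; rewrite -leye_eq.
have mf' : measurable_fun [set: R] (fun x => (f x)%:E) by exact/measurable_EFinP.
apply: (@le_trans _ _
    (\int[@lebesgue_measure R]_(x in `[1%R, +oo[) (f x)%:E)%E); last first.
  by apply: ge0_subset_integral => // x _; rewrite lee_fin.
apply: (@le_trans _ _
    (\int[@lebesgue_measure R]_(x in `[1%R, +oo[) (cst e%:E) x)%E).
  by rewrite integral_cst//= lebesgue_measure_itv/= ltry mulry gtr0_sg// mul1e.
apply: ge0_le_integral => //.
- by move=> x _; rewrite lee_fin ltW.
- exact: measurable_funS mf'.
- by move=> x /=; rewrite in_itv/= andbT => x1; rewrite lee_fin ef.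
Qed.

Lemma is_derive_0_is_cst_gt0 {R : realType} (f : R -> R) :
  (forall x : R, 0 < x -> is_derive x 1 f 0) ->
  forall x y, 0 < x -> 0 < y -> f x = f y.
Proof.
move=> df; suff H x y : 0 < x -> x <= y -> f y = f x.
  by move=> x y x0 y0; case: (leP x y) => [|/ltW] /H ->.
move=> x0 xy; apply/eqP; rewrite -subr_eq0; apply/eqP.
have pos z : (z \in `[x, y])%R -> 0 < z.
  by rewrite in_itv/= => /andP[xz _]; exact: lt_le_trans xz.
have [||z _ ->] := @MVT_segment R f (fun=> 0) x y xy.
- by move=> z zxy; apply: df; apply: pos; exact: subset_itv_oo_cc.
- by apply: derivable_within_continuous => z /pos /df[].
- by rewrite mul0r.
Qed.

(** This is the squared modulus of the modal transfer function [s / (a s^2 + c s + l)] at [s = i x].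
    At [l = x = 0] the quotient 0 / 0 takes the value 0. *)
Definition resonance {R : realType} (a c l x : R) : R :=
  x ^+ 2 / ((l - a * x ^+ 2) ^+ 2 + (c * x) ^+ 2).

(** * Modes with positive eigenvalue *)

Section Resonance.
Variables (R : realType) (a c l : R).
Hypotheses (a0 : 0 < a) (c0 : 0 < c) (l0 : 0 < l).
Let mu := @lebesgue_measure R.
Local Notation h := (resonance a c l).
Local Notation D x := ((l - a * x ^+ 2) ^+ 2 + (c * x) ^+ 2).

Lemma resonance_den_gt0 x : 0 < D x.
Proof.
have [->|x0] := eqVneq x 0.
  by rewrite expr0n/= mulr0 subr0 mulr0 expr0n/= addr0 exprn_gt0.
by rewrite ltr_wpDl ?sqr_ge0// exprn_even_gt0//= mulf_neq0// gt_eqF.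
Qed.

Lemma continuous_resonance : continuous h.
Proof.
move=> x; apply: cvgM; first exact: exprn_continuous.
apply: cvgV; first by rewrite gt_eqF// resonance_den_gt0.
apply: cvgD.
  apply: (@cvg_comp _ _ _ _ (@GRing.exp R ^~ 2)); last exact: exprn_continuous.
  apply: cvgB; first exact: cvg_cst.
  by apply: cvgM; [exact: cvg_cst|exact: exprn_continuous].
apply: (@cvg_comp _ _ _ _ (@GRing.exp R ^~ 2)); last exact: exprn_continuous.
by apply: cvgM; [exact: cvg_cst|exact: cvg_id].
Qed.

Lemma resonance_ge0 x : 0 <= h x.
Proof. by rewrite divr_ge0 ?sqr_ge0// addr_ge0// sqr_ge0. Qed.

Definition resonance_primitive (x : R) := parameterized_integral mu 0 x h.

Lemma resonance_integrable u : mu.-integrable `[0, u] (EFin \o h).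
Proof.
apply: continuous_compact_integrable; first exact: segment_compact.
by apply: continuous_subspaceT; exact: continuous_resonance.
Qed.

Lemma is_derive_resonance_primitive (x : R) :
  0 < x -> is_derive x 1 resonance_primitive (h x).
Proof.
(* The upper end [x + 1] makes [x] an interior point of the integration interval. *)
move=> x0; have xx : x < x + 1 by rewrite ltrDl.
have [dP dPE] := continuous_FTC1_closed xx (resonance_integrable (x + 1)) x0
  (continuous_resonance x).
by split; [exact: dP|rewrite -derive1E; exact: dPE].
Qed.

Lemma cvg0_resonance_primitive : resonance_primitive x @[x --> 0] --> 0.
Proof. exact: (parameterized_integral_cvg_left ltr01 (resonance_integrable 1)). Qed.

(* [reflection_defect] vanishes at the fixed point [sqrt (l / a)] of the
   reflection [x |-> l / (a x)] and has zero derivative, which gives the limit of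
   [resonance_primitive] at infinity without an explicit antiderivative. *)
Definition reflection_defect (x : R) :=
  resonance_primitive x - resonance_primitive (l / a * x^-1) -
  (a * c)^-1 * atan (c^-1 * (a * x - l * x^-1)).

(** [h] takes the same value at [x] and at [l / (a x)], so the two primitives together contribute
    [h x * (1 + l / (a x^2))]. The arctangent term has exactly this derivative. *)
Lemma is_derive_reflection_defect (x : R) :
  0 < x -> is_derive x 1 reflection_defect 0.
Proof.
move=> x0.
have xn0 : x != 0 by rewrite gt_eqF.
have dV : is_derive x 1 (fun x : R => x^-1) (- x ^- 2).
  have := is_deriveV (f := id) xn0 (is_derive_id x 1).
  by rewrite /GRing.scale /= mulr1.
have y0 : 0 < l / a * x^-1 by rewrite !(mulr_gt0,invr_gt0).
have dy : is_derive x 1 (fun x : R => l / a * x^-1) (l / a * - x ^- 2).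
  exact: (is_deriveZ (l / a) dV).
have dP2 : is_derive x 1 (fun x => resonance_primitive (l / a * x^-1)) _ :=
  is_derive1_comp (g := fun x : R => l / a * x^-1)
    (is_derive_resonance_primitive _ y0) dy.
have dax : is_derive x 1 (fun x : R => a * x) a.
  have := is_deriveZ a (is_derive_id x 1).
  by rewrite /GRing.scale /= mulr1.
have dlx : is_derive x 1 (fun x : R => l * x^-1) (l * - x ^- 2).
  exact: (is_deriveZ l dV).
have dv : is_derive x 1 (fun x : R => c^-1 * (a * x - l * x^-1))
    (c^-1 * (a - l * - x ^- 2)).
  exact: (is_deriveZ c^-1 (is_deriveB dax dlx)).
have dat := is_derive1_comp (g := fun x => c^-1 * (a * x - l * x^-1))
  (is_derive1_atan _) dv.
have := is_deriveB (is_deriveB (is_derive_resonance_primitive _ x0) dP2)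
  (is_deriveZ (a * c)^-1 dat).
move=> dR; apply: is_derive_eq dR _; rewrite /resonance /GRing.scale /=.
have Dx := resonance_den_gt0 x.
set y := l / a * x^-1.
have Dy : D y = (l / (a * x ^+ 2)) ^+ 2 * D x.
  by rewrite /y; field; rewrite xn0 gt_eqF.
rewrite Dy.
(* The argument of the arctangent is chosen so that its derivative carries the denominator of
   [h]. *)
have -> : 1 + (c^-1 * (a * x - l * x^-1)) ^+ 2 = D x / (c * x) ^+ 2.
  by field; rewrite xn0 gt_eqF.
rewrite /y; set DD := D x.
by field; rewrite xn0 !gt_eqF.
Qed.

Lemma reflection_defect_eq0 (x : R) : 0 < x -> reflection_defect x = 0.
Proof.
move=> x0; pose r := Num.sqrt (l / a).
have la0 : 0 < l / a by rewrite divr_gt0.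
have r0 : 0 < r by rewrite sqrtr_gt0.
have r2 : r ^+ 2 = l / a by rewrite sqr_sqrtr// ltW.
have rE : reflection_defect r = 0.
  have lar : l / a * r^-1 = r by rewrite -r2 expr2 mulfK// gt_eqF.
  have lr : l * r^-1 = a * r by rewrite -[in RHS]lar; field; rewrite !gt_eqF.
  by rewrite /reflection_defect lar lr !subrr mulr0 atan0 mulr0 subr0.
by rewrite -rE; apply: is_derive_0_is_cst_gt0 => //;
   exact: is_derive_reflection_defect.
Qed.

(** As the defect vanishes, the primitive at [x] is its value at [l / (a x)], which tends to 0, plus
    an arctangent term tending to [(a c)^-1 * (pi / 2)]. *)
Lemma cvgy_resonance_primitive :
  resonance_primitive x @[x --> +oo] --> pi / (2 * a * c).
Proof.
have -> : pi / (2 * a * c) = 0 + (a * c)^-1 * (pi / 2).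
  by field; rewrite !gt_eqF.
have : resonance_primitive (l / a * x^-1) +
    (a * c)^-1 * atan (c^-1 * (a * x - l * x^-1)) @[x --> +oo] -->
  0 + (a * c)^-1 * (pi / 2).
  have xV : x^-1 @[x --> +oo] --> (0 : R).
    apply/gtr0_cvgV0 => /=; last exact: cvg_id.
    by near=> x; near: x; exact: nbhs_pinfty_gt.
  apply: cvgD.
    apply: cvg_comp cvg0_resonance_primitive.
    have -> : (0 : R) = l / a * 0 by rewrite mulr0.
    by apply: cvgM; first exact: cvg_cst.
  apply: cvgM; first exact: cvg_cst.
  apply: cvg_comp (@cvgy_atan R).
  apply: gt0_cvgMry; first by rewrite invr_gt0.
  apply/cvgryPge => A; near=> x.
  have x1 : 1 <= x by near: x; exact: nbhs_pinfty_ge.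
  (* Since [l / x <= l] for [1 <= x], this threshold gives [a x - l / x >= A]. *)
  have xA : (A + l) / a <= x by near: x; exact: nbhs_pinfty_ge.
  have lx : l * x^-1 <= l.
    by apply: ler_piMr; [exact: ltW|rewrite invf_le1 // (lt_le_trans _ x1)].
  by move: xA; rewrite ler_pdivrMr// mulrC => xA; lra.
apply: cvg_trans; apply: near_eq_cvg; near=> x.
have /reflection_defect_eq0 : 0 < x by near: x; exact: nbhs_pinfty_gt.
by rewrite /reflection_defect => /subr0_eq <-; rewrite subrKC.
Unshelve. all: by end_near. Qed.

Lemma integral_resonance_gt0 : (\int[mu]_x (h x)%:E = (pi / (a * c))%:E)%E.
Proof.
have P0 : resonance_primitive 0 = 0.
  by rewrite /resonance_primitive /parameterized_integral set_itv1 Rintegral_set1.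
have -> : pi / (a * c) = 2 * (pi / (2 * a * c) - resonance_primitive 0).
  by rewrite P0; field; rewrite !gt_eqF.
apply: (@even_ge0_FTC _ h resonance_primitive).
- exact: resonance_ge0.
- exact: continuous_resonance.
- by move=> x; rewrite /resonance mulrN !sqrrN.
- exact: is_derive_resonance_primitive.
- by rewrite P0; apply: cvg_at_right_filter; exact: cvg0_resonance_primitive.
- exact: cvgy_resonance_primitive.
Qed.

End Resonance.

(** * The zero eigenvalue and the common value of all modes *)

(** Cancelling [x ^+ 2] is legitimate only away from 0: at 0 the left side is 0 and the right side
    is [c ^- 2]. *)
Lemma resonance0E {R : realType} (a c x : R) : 0 < c -> x != 0 ->
  resonance a c 0 x = ((a * x) ^+ 2 + c ^+ 2)^-1.
Proof.
move=> c0 x0; rewrite /resonance; field.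
have ac : 0 < (a * x) ^+ 2 + c ^+ 2 by rewrite ltr_wpDl ?sqr_ge0// exprn_gt0.
have cx : 0 < (c * x) ^+ 2 by rewrite exprn_even_gt0//= mulf_neq0// gt_eqF.
by rewrite !gt_eqF// ltr_wpDl ?sqr_ge0.
Qed.

Lemma continuous_resonance0 {R : realType} (a c : R) : 0 < c ->
  continuous (fun x : R => ((a * x) ^+ 2 + c ^+ 2)^-1).
Proof.
move=> c0 x; apply: cvgV.
  by rewrite gt_eqF// ltr_wpDl ?sqr_ge0// exprn_gt0.
apply: cvgD; last exact: cvg_cst.
apply: (@cvg_comp _ _ _ _ (@GRing.exp R ^~ 2)); last exact: exprn_continuous.
by apply: cvgM; [exact: cvg_cst|exact: cvg_id].
Qed.

(** For [l = 0] the reflection degenerates, but [G] is an explicit arctangent primitive of the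
    continuous extension [g]. *)
Lemma integral_resonance0 {R : realType} (a c : R) : 0 < a -> 0 < c ->
  (\int[@lebesgue_measure R]_x (resonance a c 0 x)%:E = (pi / (a * c))%:E)%E.
Proof.
move=> a0 c0; pose g (x : R) := ((a * x) ^+ 2 + c ^+ 2)^-1.
have g0 x : 0 < (a * x) ^+ 2 + c ^+ 2 by rewrite ltr_wpDl ?sqr_ge0// exprn_gt0.
have cg : continuous g by exact: continuous_resonance0.
transitivity (\int[@lebesgue_measure R]_x (g x)%:E)%E.
  apply: (eq_integral_off_point 0); first exact: continuous_measurable_fun.
  by move=> x; exact: resonance0E.
pose G (x : R) := (a * c)^-1 * atan (a / c * x).
have G0 : G 0 = 0 by rewrite /G mulr0 atan0 mulr0.
have dG (x : R) : is_derive x 1 G (g x).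
  have dx : is_derive x 1 (fun x : R => a / c * x) (a / c).
    have := is_deriveZ (a / c) (is_derive_id x 1).
    by rewrite /GRing.scale /= mulr1.
  have := is_deriveZ (a * c)^-1
    (is_derive1_comp (g := fun x => a / c * x) (is_derive1_atan _) dx).
  move=> dG; apply: is_derive_eq dG _; rewrite /GRing.scale /= /g.
  have -> : 1 + (a / c * x) ^+ 2 = ((a * x) ^+ 2 + c ^+ 2) / c ^+ 2.
    by field; rewrite gt_eqF.
  by field; rewrite !gt_eqF.
have -> : pi / (a * c) = 2 * ((a * c)^-1 * (pi / 2) - G 0).
  by rewrite G0; field; rewrite !gt_eqF.
apply: (@even_ge0_FTC _ g G).
- by move=> x; rewrite invr_ge0 ltW.
- exact: cg.
- by move=> x; rewrite /g mulrN sqrrN.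
- apply: cvg_at_right_filter; apply: differentiable_continuous.
  by apply/derivable1_diffP; have [] := dG 0.
- apply: cvgM; first exact: cvg_cst.
  apply: cvg_comp (@cvgy_atan R).
  by apply: gt0_cvgMry; [rewrite divr_gt0|exact: cvg_id].
Qed.

(** The value is the same for every eigenvalue, so the network topology drops out of the norm. *)
Lemma integral_resonance {R : realType} (a c l : R) : 0 < a -> 0 < c -> 0 <= l ->
  (\int[@lebesgue_measure R]_x (resonance a c l x)%:E = (pi / (a * c))%:E)%E.
Proof.
move=> a0 c0; rewrite le_eqVlt => /predU1P[<-|l0].
  exact: integral_resonance0.
exact: integral_resonance_gt0.
Qed.

Lemma measurable_resonance {R : realType} (a c l : R) : 0 < c -> 0 <= l ->
  measurable_fun [set: R] (resonance a c l).
Proof.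
move=> c0; rewrite le_eqVlt => /predU1P[<-|l0].
  apply: (@measurable_fun_off_point R 0 _ (fun x => ((a * x) ^+ 2 + c ^+ 2)^-1)).
    by apply: continuous_measurable_fun; exact: continuous_resonance0.
  by move=> x; exact: resonance0E.
by apply: continuous_measurable_fun; exact: continuous_resonance.
Qed.

End Integrals.

(** * Laplacian spectrum and transfer function *)

Section Network.
Local Open Scope complex_scope.
Local Open Scope sesquilinear_scope.

(** Each line occurs in both orientations on the right, hence the factor 2 on the left. *)
Lemma laplacian_quad {R : realType} {n : nat} (P : network R n) (x : 'I_n -> R[i]) :
  2 * (\sum_i \sum_j x i * (laplacian P i j)%:C * (x j)^*%C) =
  \sum_i \sum_(j | line P i j) (suscept P i j)%:C * `|x i - x j| ^+ 2.
Proof.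
(* Extending the susceptances by 0 lets all sums range over all pairs of buses. *)
pose b i j : R[i] := if line P i j then (suscept P i j)%:C else 0.
have bC i j : b i j = b j i by rewrite /b line_sym suscept_sym.
have Lij i j : (laplacian P i j)%:C = (if i == j then \sum_k b i k else 0) - b i j.
  rewrite mxE /b; case: eqVneq => [->|ij].
    rewrite line_irr subr0 rmorph_sum /= [LHS]big_mkcond /=.
    by apply: eq_bigr.
  by case: ifP => _; rewrite ?rmorphN/= sub0r// oppr0.
have -> : \sum_i \sum_j x i * (laplacian P i j)%:C * (x j)^*%C =
   \sum_i \sum_j (b i j * (x i * (x i)^*%C) - b i j * (x i * (x j)^*%C)).
  apply: eq_bigr => i _.
  transitivity (\sum_j ((if i == j then \sum_k b i k else 0) *
      (x i * (x j)^*%C) - b i j * (x i * (x j)^*%C))).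
    by apply: eq_bigr => j _; rewrite Lij mulrAC mulrC mulrBl.
  rewrite !sumrB; congr (_ - _).
  rewrite -mulr_suml; set s := \sum_k b i k.
  rewrite (bigD1 i)//= eqxx big1 ?addr0// => j /negPf.
  by rewrite eq_sym => ->; rewrite mul0r.
transitivity (\sum_i \sum_j b i j * `|x i - x j| ^+ 2); last first.
  apply: eq_bigr => i _; rewrite [RHS]big_mkcond; apply: eq_bigr => j _.
  by rewrite /b; case: ifP => //; rewrite mul0r.
(* The doubled form is the form plus its copy with [i] and [j] exchanged; symmetry of [b] then
   allows a termwise expansion of the squared modulus. *)
rewrite mulr_natl mulr2n {2}exchange_big -big_split /=; apply: eq_bigr => i _.
rewrite -big_split /=; apply: eq_bigr => j _.
by rewrite (bC j i) sqr_normc rmorphB /=; ring.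
Qed.

Lemma laplacian_psd {R : realType} {n : nat} (P : network R n) (x : 'I_n -> R[i]) :
  0 <= \sum_i \sum_j x i * (laplacian P i j)%:C * (x j)^*%C.
Proof.
rewrite -(pmulr_rge0 _ (ltr0Sn _ 1)) laplacian_quad.
apply: sumr_ge0 => i _; apply: sumr_ge0 => j lij.
by rewrite mulr_ge0 ?exprn_ge0// lecR ltW// suscept_gt0.
Qed.

Lemma laplacian_hermitian {R : realType} {n : nat} (P : network R n) :
  complexify (laplacian P) \is hermsymmx.
Proof.
apply: realsym_hermsym.
  apply/is_hermitianmxP; rewrite expr0 scale1r map_mx_id//.
  apply/matrixP => i j; rewrite !mxE eq_sym line_sym suscept_sym.
  by case: eqVneq => [->|].
by apply/mxOverP => i j; rewrite mxE complex_real.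
Qed.

(** The spectral theorem for Hermitian matrices; each eigenvalue is the Laplacian form evaluated on
    a row of [U], hence nonnegative. *)
Lemma laplacian_spectrum {R : realType} {n : nat} (P : network R n) :
  exists (U : 'M[R[i]]_n) (lam : 'I_n -> R),
    [/\ U *m U^t* = 1%:M, U^t* *m U = 1%:M, forall i, 0 <= lam i &
        complexify (laplacian P) = U^t* *m diag_mx (\row_i (lam i)%:C) *m U].
Proof.
set L := complexify _.
have Lh : L \is hermsymmx := laplacian_hermitian P.
have Lr := hermitian_spectral_diag_real Lh.
have Uu := spectral_unitarymx L.
have /orthomx_spectralP := hermitian_normalmx Lh.
rewrite invmx_unitary//; set U := spectralmx L; set e := spectral_diag L => LE.
have UU : U *m U^t* = 1%:M by exact/unitarymxP.
have UU' : U^t* *m U = 1%:M by exact: mulmx1C.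
have eE i : e 0 i = (complex.Re (e 0 i))%:C.
  by rewrite RRe_real//; exact: (mxOverP Lr).
exists U, (fun i => complex.Re (e 0 i)); split => //; last first.
  by rewrite {1}LE; congr (_ *m diag_mx _ *m _); apply/rowP => i; rewrite !mxE -eE.
move=> i; rewrite -ler0c -eE.
have := laplacian_psd P (fun j => U i j).
suff -> : \sum_j \sum_k U i j * (laplacian P j k)%:C * (U i k)^*%C = e 0 i by [].
transitivity ((U *m L *m U^t*) i i).
  rewrite mxE [LHS]exchange_big /=; apply: eq_bigr => k _.
  by rewrite mxE mulr_suml; apply: eq_bigr => j _; rewrite !mxE.
by rewrite {1}LE !mulmxA UU mul1mx -mulmxA UU mulmx1 mxE eqxx.
Qed.

(** * Resolvent and closed form of the transfer function *)

(** Eliminating the frequency block leaves [a s^2 + c s + L] acting on the angles, with inverse [T].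
    The lower left block equals [- L T], written so that only multiples of [T] and the identity
    occur. *)
Lemma swing_resolvent {F : fieldType} {n : nat} (a c s : F) (L T : 'M[F]_n) :
  a != 0 -> ((a * s ^+ 2 + c * s)%:M + L) *m T = 1%:M ->
  invmx (block_mx s%:M (- 1%:M) (a^-1 *: L) (s + c / a)%:M) =
  block_mx ((a * s + c) *: T) (a *: T)
           ((s * (a * s + c)) *: T - 1%:M) ((s * a) *: T).
Proof.
move=> a0 QT; set S := block_mx _ _ _ _; set E := block_mx _ _ _ _.
have LT : L *m T = 1%:M - (a * s ^+ 2 + c * s) *: T.
  by rewrite -QT mulmxDl mul_scalar_mx addrC addKr.
suff SE : S *m E = 1%:M.
  rewrite -[LHS]mulmx1 -SE mulmxA mulVmx ?mul1mx//.
  by case: (mulmx1_unit SE).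
rewrite mulmx_block !mul_scalar_mx !mulNmx !mul1mx -!scalemxAl -!scalemxAr LT.
by rewrite scalar_mx_block; congr block_mx; apply/matrixP => i j; rewrite !mxE;
  case: (i == j); rewrite ?mulr1n ?mulr0n; field.
Qed.

Lemma diag_of_const {R : realType} {n : nat} (f : 'I_n -> R) (x : R) :
  (forall i, f i = x) -> diag_of f = x%:M.
Proof. by move=> fx; apply/matrixP => i j; rewrite !mxE fx. Qed.

Section Homogeneous.
Context {R : realType} {n : nat} (P : network R n) (m mv d rg rr k1 k2 k3 : R).
Hypothesis Phom : homogeneous P m mv d rg rr k1 k2 k3.
Let a := m + mv.
Let c := d + rg^-1 + rr^-1.

(** The output reads the frequency block and the noise enters only there, so just the block
    [(s a) T] of the resolvent survives. Substituting [s w2] for [w3] merges the last two noise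
    channels. *)
Lemma network_transferE (s : R[i]) (T : 'M[R[i]]_n) : a != 0 ->
  ((a%:C * s ^+ 2 + c%:C * s)%:M + complexify (laplacian P)) *m T = 1%:M ->
  network_transfer P s =
    s *: T *m row_mx k1%:C%:M (- ((k2 / rr)%:C + s * (mv * k3)%:C))%:M.
Proof.
move=> a0 QT.
have MhatE : Mhat P = a%:M.
  rewrite /Mhat /Mv (@diag_of_const _ _ _ m) ?(@diag_of_const _ _ _ mv) -?raddfD//;
  by move=> i; case: (Phom i) => -[? []].
have RgE : invmx (Rg P) = rg^-1%:M.
  by rewrite /Rg (@diag_of_const _ _ _ rg) ?invmx_scalar// => i; case: (Phom i) => _ [[]].
have RrE : invmx (Rr P) = rr^-1%:M.
  by rewrite /Rr (@diag_of_const _ _ _ rr) ?invmx_scalar// => i; case: (Phom i) => _ [[]].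
have DhatE : Dhat P = c%:M.
  rewrite /Dhat RgE RrE (@diag_of_const _ _ _ d) -?raddfD//.
  by move=> i; case: (Phom i) => -[_ []].
have K1E : K1 P = k1%:M by apply: diag_of_const => i; case: (Phom i) => _ [_ []].
have K2E : K2 P = k2%:M by apply: diag_of_const => i; case: (Phom i) => _ [_ [_ []]].
have K3E : K3 P = k3%:M by apply: diag_of_const => i; case: (Phom i) => _ [_ [_ []]].
have MvE : Mv P = mv%:M by apply: diag_of_const => i; case: (Phom i) => -[_ []].
rewrite /network_transfer /transfer.
have -> : s%:M - complexify (sysA P) =
    block_mx s%:M (- 1%:M) (a%:C^-1 *: complexify (laplacian P)) (s + c%:C / a%:C)%:M.
  rewrite /sysA MhatE DhatE invmx_scalar !mul_scalar_mx /complexify map_block_mx.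
  rewrite scalar_mx_block opp_block_mx add_block_mx !raddf0 addr0 !add0r.
  rewrite !map_mxN !opprK map_mxZ scale_scalar_mx !map_scalar_mx rmorph1.
  by rewrite -raddfD/= rmorphM/= !fmorphV/= mulrC.
rewrite (@swing_resolvent _ _ _ _ _ _ T)//; last first.
  by rewrite -(rmorph0 (real_complex R)) (inj_eq (@complexI R)).
rewrite /sysC /sysB /noise_input MhatE RrE K1E K2E K3E MvE invmx_scalar.
rewrite /complexify map_row_mx map_col_mx !raddf0/= map_mx1.
rewrite mul_row_block !mul0mx !add0r !mul1mx mul_row_col mulmx0 add0r.
rewrite map_mxM !map_row_mx !map_mxN !map_mxM !map_scalar_mx/=.
rewrite -!mulmxA !mul_row_col.
rewrite -!scalar_mxM -!raddfN/= !mul_scalar_mx !scale_row_mx !scaler0.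
rewrite !add_row_mx !add0r addr0 !scalemx1 !scale_scalar_mx -!raddfD/=.
(* The factor [a] of the resolvent block cancels against [invmx Mhat]. *)
rewrite -scalemxAr scalemxAl scalerA mulrCA -rmorphM/= mulVf// rmorph1 mulr1.
congr (_ *m row_mx _ _%:M).
by rewrite -!rmorphM/= [rr^-1 * k2]mulrC mulNr -opprD [_ * s]mulrC.
Qed.

(** By cyclicity the trace is that of [H H^*]. The noise factor of [H] contributes a scalar matrix,
    and the remaining factor [s T] is diagonal in the basis [U] with entries [s / q i]. *)
Lemma network_transfer_trace (U : 'M[R[i]]_n) (lam : 'I_n -> R) (xi : R) :
  0 < a -> 0 < c -> xi != 0 ->
  U *m U^t* = 1%:M -> U^t* *m U = 1%:M ->
  complexify (laplacian P) = U^t* *m diag_mx (\row_i (lam i)%:C) *m U ->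
  complex.Re (\tr (adjoint_mx (network_transfer P (0 +i* xi)) *m
                   network_transfer P (0 +i* xi))) =
  (k1 ^+ 2 + (k2 / rr) ^+ 2 + (xi * (mv * k3)) ^+ 2) *
  \sum_i resonance a c (lam i) xi.
Proof.
move=> a0 c0 xi0 UU UU' LE.
set s := 0 +i* xi.
pose q i := a%:C * s ^+ 2 + c%:C * s + (lam i)%:C.
have qE i : q i = (lam i - a * xi ^+ 2) +i* (c * xi).
  by rewrite /q /s expr2; simpc; congr (_ +i* _); ring.
(* The imaginary part [c * xi] is nonzero: damping keeps every mode invertible away from zero
   frequency. *)
have q0 i : q i != 0.
  by rewrite qE eq_complex /= negb_and mulf_neq0 ?orbT// gt_eqF.
pose T := U^t* *m diag_mx (\row_i (q i)^-1) *m U.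
have QT : ((a%:C * s ^+ 2 + c%:C * s)%:M + complexify (laplacian P)) *m T = 1%:M.
  have -> : (a%:C * s ^+ 2 + c%:C * s)%:M + complexify (laplacian P) =
      U^t* *m diag_mx (\row_i q i) *m U.
    have -> : diag_mx (\row_i q i) =
       (a%:C * s ^+ 2 + c%:C * s)%:M + diag_mx (\row_i (lam i)%:C).
      by apply/matrixP => i j; rewrite !mxE -mulrnDl.
    rewrite mulmxDr mulmxDl -LE; congr (_ + _).
    by rewrite mul_mx_scalar -scalemxAl UU' scalemx1.
  rewrite /T !mulmxA -(mulmxA _ U) UU mulmx1 -(mulmxA _ (diag_mx _) (diag_mx _)).
  rewrite mulmx_diag.
  have -> : diag_mx (\row_j ((\row_i q i) 0 j * (\row_i (q i)^-1) 0 j)) = 1%:M.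
    by apply/matrixP => i j; rewrite !mxE divff.
  by rewrite mulmx1.
rewrite (network_transferE _ _ (lt0r_neq0 a0) QT) mxtrace_mulC.
set al := k1%:C; set be := - _; set W := row_mx _ _.
have WW : W *m adjoint_mx W = (al * al^* + be * be^*)%:M.
  rewrite /W /adjoint_mx tr_row_mx map_col_mx mul_row_col !tr_scalar_mx.
  by rewrite !map_scalar_mx -!scalar_mxM -raddfD.
have adjM p1 p2 p3 (A : 'M[R[i]]_(p1, p2)) (B : 'M[R[i]]_(p2, p3)) :
    adjoint_mx (A *m B) = adjoint_mx B *m adjoint_mx A.
  by rewrite /adjoint_mx trmx_mul map_mxM.
rewrite adjM mulmxA -(mulmxA _ W) WW mul_mx_scalar -scalemxAl mxtraceZ.
have -> : \tr (s *: T *m adjoint_mx (s *: T)) =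
    (\sum_i resonance a c (lam i) xi)%:C.
  rewrite /T scalemxAl scalemxAr -[X in adjoint_mx X]mulmxA !adjM.
  have -> : adjoint_mx (U^t*) = U by exact: trmxCK.
  rewrite !mulmxA -(mulmxA _ U) UU mulmx1 mxtrace_mulC !mulmxA UU mul1mx.
  rewrite /mxtrace rmorph_sum; apply: eq_bigr => i _ /=.
  rewrite -scalemxAl mxE mul_diag_mx /adjoint_mx !mxE eqxx mulr1n.
  have -> : s * ((q i)^-1 * (s / q i)^*%C) = `|s / q i| ^+ 2.
    by rewrite sqr_normc mulrA.
  rewrite normf_div exprMn exprVn -!add_Re2_Im2 qE /= -fmorphV -rmorphM/=.
  by rewrite /resonance expr0n add0r.
rewrite -!sqr_normc -!add_Re2_Im2 -!rmorphD -rmorphM /=.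
by congr (_ * _); rewrite !(mul0r,mulr0,oppr0,subr0,addr0,add0r); ring.
Qed.

End Homogeneous.

End Network.

(** * Divergence bound and evaluation of the two norms *)

(** Derivative noise brings a factor [x^2] that offsets the decay of the modal gain: for [1 <= x]
    one has [|l - a x^2| <= (l + a) x^2] and [(c x)^2 <= c^2 x^4], so the denominator is at most
    [x^4 ((l + a)^2 + c^2)]. *)
Lemma resonance_energy_lower_bound {R : realType} (a c l x : R) :
  0 < a -> 0 < c -> 0 <= l -> 1 <= x ->
  ((l + a) ^+ 2 + c ^+ 2)^-1 <= x ^+ 2 * resonance a c l x.
Proof.
move=> a0 c0 l0 x1.
have x2 : 1 <= x ^+ 2 by rewrite exprn_ege1.
have x0 : 0 < x := lt_le_trans ltr01 x1.
have c2 : 0 < c ^+ 2 by rewrite exprn_gt0.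
have D0 : 0 < (l - a * x ^+ 2) ^+ 2 + (c * x) ^+ 2.
  by rewrite ltr_wpDl ?sqr_ge0// exprn_gt0// mulr_gt0.
rewrite /resonance mulrA ler_pdivlMr// mulrC ler_pdivrMr; last first.
  by rewrite ltr_wpDl ?sqr_ge0.
rewrite -expr2.
have lx : l <= l * x ^+ 2 by rewrite ler_peMr.
have ax : 0 < a * x ^+ 2 by rewrite mulr_gt0// exprn_gt0.
have -> : (x ^+ 2) ^+ 2 * ((l + a) ^+ 2 + c ^+ 2) =
    (l * x ^+ 2 + a * x ^+ 2) ^+ 2 + (c * x) ^+ 2 * x ^+ 2 by ring.
rewrite lerD//; last by rewrite ler_peMr// sqr_ge0.
rewrite -real_normK ?num_real// ler_sqr ?nnegrE ?normr_ge0//; last by lra.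
by rewrite ler_norml; apply/andP; split; lra.
Qed.

Theorem theorem2 (R : realType) (n : nat) (P : network R n)
    (m mv d rg rr k1 k2 k3 : R)
    (Phom : homogeneous P m mv d rg rr k1 k2 k3) :
  (mv = 0 -> k3 = 0 ->
     H2norm_sq (network_transfer P) =
     (n%:R * (k1 ^+ 2 + (k2 / rr) ^+ 2)
      / (2 * m * (d + 1 / rg + 1 / rr)))%:E) /\
  (0 < mv -> k3 != 0 -> H2norm_sq (network_transfer P) = +oo%E).
Proof.
(* One bus suffices to read off the signs of the common parameters; the same index later selects the
   mode that forces divergence. *)
pose i0 := Ordinal (bus_nonempty P).
have [[mE [mvE dE]] [[rgE rrE] _]] := Phom i0.
have m0 : 0 < m by rewrite -mE inertia_gt0.
have mv0 : 0 <= mv by rewrite -mvE vinertia_ge0.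
have d0 : 0 < d by rewrite -dE damping_gt0.
have rg0 : 0 < rg by rewrite -rgE gen_droop_gt0.
have rr0 : 0 < rr by rewrite -rrE inv_droop_gt0.
have a0 : 0 < m + mv by rewrite ltr_wpDr.
have c0 : 0 < d + rg^-1 + rr^-1 by rewrite !addr_gt0 ?invr_gt0.
have [U [lam [UU UU' lam0 LE]]] := laplacian_spectrum P.
set a := m + mv in a0; set c := d + rg^-1 + rr^-1 in c0.
have mres i : measurable_fun [set: R] (resonance a c (lam i)).
  exact: measurable_resonance.
have mresE i : measurable_fun [set: R] (fun x => (resonance a c (lam i) x)%:E).
  by apply/measurable_EFinP; exact: mres.
have res0 i x : 0 <= resonance a c (lam i) x by exact: resonance_ge0.
pose K : R := k1 ^+ 2 + (k2 / rr) ^+ 2.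
have K0 : 0 <= K by rewrite addr_ge0 ?sqr_ge0.
pose g (x : R) := (K + (x * (mv * k3)) ^+ 2) * \sum_i resonance a c (lam i) x.
have mg : measurable_fun [set: R] g.
  apply: measurable_funM; last exact: measurable_sum.
  apply: measurable_funD => //; apply: measurable_funX.
  by apply: measurable_funM.
have HE : H2norm_sq (network_transfer P) =
    (((2 * pi)^-1)%:E * \int[@lebesgue_measure R]_x (g x)%:E)%E.
  congr (_ * _)%E; apply: (eq_integral_off_point 0) => // x x0.
  exact: network_transfer_trace Phom _ _ _ a0 c0 x0 UU UU' LE.
have pi2 : 0 < (2 * pi)^-1 :> R by rewrite invr_gt0 mulr_gt0 ?pi_gt0.
rewrite HE; split=> [mv0' k30|mvgt0 k3n0].
  (* Without derivative noise the weight is the constant [K], and the [n] modes contribute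
     [pi / (a c)] each. *)
  have gE x : (g x)%:E = (K%:E * \sum_i (resonance a c (lam i) x)%:E)%E.
    by rewrite /g k30 mulr0 mulr0 expr0n addr0 EFinM sumEFin.
  under eq_integral do rewrite gE.
  rewrite ge0_integralZl_EFin//; last 2 first.
  - by move=> x _; apply: sume_ge0 => i _; rewrite lee_fin.
  - by apply: emeasurable_sum => i; exact: mresE.
  rewrite ge0_integral_sum//; last first.
    by move=> i x _; rewrite lee_fin.
  under eq_bigr do rewrite integral_resonance//.
  rewrite sumEFin sumr_const card_ord -!EFinM; congr EFin.
  rewrite /K /a mv0' addr0 !div1r -/c -mulr_natl.
  (* [pi] is generalized to an arbitrary nonzero [p], which [field] cancels. *)
  move: (@pi R) (lt0r_neq0 (pi_gt0 R)) => p p0; field.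
  by rewrite p0 !gt_eqF.
(* The constant is the lower bound for mode [i0] scaled by [(mv * k3) ^+ 2]; [K] and the other modes
   are nonnegative and are dropped. *)
rewrite (@integral_ge1_pinfty R g ((mv * k3) ^+ 2 / ((lam i0 + a) ^+ 2 + c ^+ 2)))//.
- by rewrite gt0_muley// lte_fin.
- by move=> x; rewrite mulr_ge0 ?addr_ge0 ?sqr_ge0// sumr_ge0.
- apply: divr_gt0; last by rewrite ltr_wpDl ?sqr_ge0 ?exprn_gt0.
  by rewrite exprn_even_gt0//= mulf_neq0// gt_eqF.
- move=> x x1; have := resonance_energy_lower_bound _ _ _ _ a0 c0 (lam0 i0) x1.
  set r := resonance _ _ _ _ => rx.
  apply: (@le_trans _ _ ((x * (mv * k3)) ^+ 2 * r)).
    rewrite (_ : (x * (mv * k3)) ^+ 2 * r = (mv * k3) ^+ 2 * (x ^+ 2 * r)); last by ring.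
    by apply: ler_wpM2l; rewrite ?sqr_ge0.
  rewrite /g; apply: ler_pM; rewrite ?sqr_ge0 ?res0 ?lerDr//.
  by rewrite (bigD1 i0)//= lerDl sumr_ge0.
Qed.
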